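(* Let $R$ be a noetherian commutative ring with identity and let $X$ be a set. The free averaging $R$-algebra $(F_X,f_X)$ on $X$ is a noetherian averaging $R$-algebra if and only if $X=\emptyset$.
   Context: All rings and algebras are commutative with identity. An averaging operator on an $R$-algebra $A$ is an $R$-module endomorphism $f:A\to A$ with $f(xf(y))=f(x)f(y)$ for all $x,y\in A$; $(A,f)$ is then an averaging $R$-algebra. An averaging ideal of $(A,f)$ is an ideal $I$ of $A$ with $f(I)\subseteq I$. $(A,f)$ is a noetherian averaging $R$-algebra if there is no infinite strictly ascending chain $I_1\subset I_2\subset\cdots\subset I_n\subset\cdots$ of averaging ideals of $(A,f)$. The free averaging $R$-algebra on a set $X$ is $(F_X,f_X)$: let $\Theta(X)$ be the set of monomials of $R[X]$ with coefficient $1_R$ (including $1_R$), let $Y=\{y_\theta:\theta\in\Theta(X)\}$ be a set of symbols, pairwise distinct for distinct $\theta$ and disjoint from $X$; then $F_X=R[X\cup Y]$ is the polynomial algebra and $f_X$ is the $R$-linear map with $f_X(uv)=y_uv$ for $u\in\Theta(X)$, $v\in R[Y]$.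
   Formalization: The ring R is assumed to be nonzero: over the zero ring the free averaging algebra is zero, hence noetherian, for every set X, so the claim fails there for nonempty X. *)

(* Defs.v *)
From HB Require Import structures.
From mathcomp Require Import all_boot all_algebra finmap.
From mathcomp Require Import monalg.

Set Implicit Arguments.
Unset Strict Implicit.
Unset Printing Implicit Defensive.

Import GRing.Theory.
Local Open Scope ring_scope.

(* [comNzRingType] is needed below rather than [comPzRingType]: over the zero
   ring the free averaging algebra on any X is zero, hence noetherian. *)
Definition is_ideal (A : comNzRingType) (I : A -> Prop) : Prop :=
  [/\ I 0, forall a b, I a -> I b -> I (a + b) & forall a b, I b -> I (a * b)].

Definition strictly_ascending (A : Type) (I : nat -> A -> Prop) : Prop :=
  forall n, (forall a, I n a -> I n.+1 a) /\ (exists a, I n.+1 a /\ ~ I n a).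

Definition noetherian_ring (A : comNzRingType) : Prop :=
  ~ exists I : nat -> A -> Prop,
      (forall n, is_ideal (I n)) /\ strictly_ascending I.

Definition is_averaging (A : comNzRingType) (f : A -> A) : Prop :=
  forall x y, f (x * f y) = f x * f y.

Record averagingAlg (R : comNzRingType) := AveragingAlg {
  avg_alg :> comAlgType R;
  avg_op : {linear avg_alg -> avg_alg};
  avg_opP : is_averaging avg_op
}.

Definition is_averaging_ideal (R : comNzRingType) (A : averagingAlg R)
    (I : A -> Prop) : Prop :=
  is_ideal I /\ (forall a, I a -> I (avg_op A a)).

Definition noetherian_averaging (R : comNzRingType) (A : averagingAlg R) :
    Prop :=
  ~ exists I : nat -> A -> Prop,
      (forall n, is_averaging_ideal (I n)) /\ strictly_ascending I.

Section MonomialMap.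
Variables (R : comNzRingType) (K : conomType) (phi : K -> K).
Implicit Types (g v x y : {malg R[K]}) (m n u w : K).

Definition monlin g : {malg R[K]} :=
  \sum_(m <- msupp g) g@_m *: (<< phi m >> : {malg R[K]}).

Lemma malgUM m n : (<< mmul m n >> : {malg R[K]}) = << m >> * << n >>.
Proof. by rewrite malgM_def fgmulUU mulr1. Qed.

Lemma malg_sumU v : v = \sum_(m <- msupp v) v@_m *: (<< m >> : {malg R[K]}).
Proof.
rewrite {1}[v]monalgE; apply: eq_bigr => m _.
apply/malgP => k; rewrite mcoeffZ mcoeffU mcoeffU1.
by case: (m == k); rewrite ?mulr1 ?mulr0.
Qed.

Lemma malg_lin_ind (P : {malg R[K]} -> Prop) :
  P 0 -> (forall c x y, P x -> P y -> P (c *: x + y)) ->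
  (forall m, P << m >>) -> forall v, P v.
Proof.
move=> P0 PD PU v; rewrite (malg_sumU v).
elim: (X in \sum_(m <- X) _) => [|m s IHs]; first by rewrite big_nil.
by rewrite big_cons; apply: PD.
Qed.

Lemma monlinEw (d : {fset K}) g : (msupp g `<=` d)%fset ->
  monlin g = \sum_(m <- d) g@_m *: (<< phi m >> : {malg R[K]}).
Proof.
move=> le_gd; apply: big_fset_incl => // m _ /mcoeff_outdom ->.
by rewrite scale0r.
Qed.

Lemma monlinP c x y : monlin (c *: x + y) = c *: monlin x + monlin y.
Proof.
pose d := (msupp (c *: x + y) `|` (msupp x `|` msupp y))%fset.
rewrite !(@monlinEw d) ?fsubsetUl //.
- rewrite scaler_sumr -big_split; apply: eq_bigr => m _ /=.
  by rewrite mcoeffD mcoeffZ scalerDl scalerA.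
- by rewrite /d fsubsetU // fsubsetUr orbT.
- by rewrite /d fsubsetU // fsubsetUl orbT.
Qed.

HB.instance Definition _ :=
  GRing.isLinear.Build R {malg R[K]} {malg R[K]} *:%R monlin monlinP.

Lemma monlinU m : monlin << m >> = << phi m >>.
Proof. by rewrite (monlinEw msuppU_le) big_seq_fset1 mcoeffUU scale1r. Qed.

Lemma monlinM u w v : {in msupp v, forall m, phi (mmul u m) = mmul w m} ->
  monlin (<< u >> * v) = << w >> * v.
Proof.
move=> phiE; rewrite (malg_sumU v) mulr_sumr linear_sum [RHS]mulr_sumr.
apply: eq_big_seq => m /phiE Em.
by rewrite -!scalerAr -!malgUM -Em -monlinU; apply: linearZ.
Qed.

Lemma monlin_averaging :
  (forall m n, phi (mmul m (phi n)) = mmul (phi m) (phi n)) ->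
  is_averaging monlin.
Proof.
move=> phiA x y; elim/malg_lin_ind: x => [|c x1 x2 IH1 IH2|m].
- by rewrite mul0r linear0 mul0r.
- by rewrite mulrDl -scalerAl !monlinP IH1 IH2 mulrDl -scalerAl.
elim/malg_lin_ind: y => [|c y1 y2 IH1 IH2|n].
- by rewrite linear0 mulr0 linear0 mulr0.
- by rewrite monlinP mulrDr -scalerAr monlinP IH1 IH2 mulrDr -scalerAr.
by rewrite !monlinU -!malgUM monlinU phiA.
Qed.

End MonomialMap.

Section FreeAveraging.
Variables (R : comNzRingType) (X : choiceType).

(* Theta(X) is [{cmonom X}]; the indeterminates X U Y are the disjoint sum of
   the [inl x] for x in X and of the symbols y_theta, encoded as [inr theta]. *)
Definition free_var : choiceType := (X + {cmonom X})%type.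

Definition var_x (x : X) : free_var := inl x.
Definition var_y (u : {cmonom X}) : free_var := inr u.

Definition left_var (i : free_var) : option X :=
  if i is inl x then Some x else None.

Definition monX (u : {cmonom X}) : {cmonom free_var} :=
  [cmonom (if left_var i is Some x then u x else 0%N)
    | i in [fset var_x x | x in finsupp u]%fset]%M.

(* Every monomial m on X U Y factors uniquely as uv with u in Theta(X) and v a
   monomial in the y_theta: [partX m] is u and [partY m] is v. *)
Definition partX (m : {cmonom free_var}) : {cmonom X} :=
  [cmonom m (var_x x) | x in seq_fset tt (pmap left_var (finsupp m))]%M.

Definition partY (m : {cmonom free_var}) : {cmonom free_var} :=
  [cmonom (if left_var i is Some _ then 0%N else m i) | i in finsupp m]%M.

Definition free_mon (m : {cmonom free_var}) : {cmonom free_var} :=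
  mmul (ucm (var_y (partX m))) (partY m).

Definition free_op :
    {malg R[{cmonom free_var}]} -> {malg R[{cmonom free_var}]} :=
  monlin free_mon.

HB.instance Definition _ := GRing.Linear.on free_op.

Lemma left_varE i x : left_var i = Some x -> i = var_x x.
Proof. by case: i => //= ? [->]. Qed.

Lemma monXE u i : monX u i = if left_var i is Some x then u x else 0%N.
Proof.
rewrite cmE fsfun_fun; case: ifPn => // /negP notin.
case E: (left_var i) => [x|//]; move: E notin => /left_varE ->.
case: (finsuppP u x) => // xu []; exact/in_imfset.
Qed.

Lemma partXE m x : partX m x = m (var_x x).
Proof.
rewrite cmE fsfun_fun seq_fsetE mem_pmap.
case: ifPn => // /negP notin; case: (finsuppP m (var_x x)) => // xm.
by case: notin; apply/mapP; exists (var_x x).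
Qed.

Lemma partYE m i : partY m i = if left_var i is Some _ then 0%N else m i.
Proof.
by rewrite cmE fsfun_fun; case: (finsuppP m i) => //; case: left_var.
Qed.

Lemma mon_decomp m : m = mmul (monX (partX m)) (partY m).
Proof.
apply/eqP/cmP => i; rewrite cmM monXE partYE.
case E: (left_var i) => [x|//].
by rewrite (left_varE E) partXE addn0.
Qed.

Lemma free_monM (m n : {cmonom free_var}) : (forall x, n (var_x x) = 0%N) ->
  free_mon (mmul m n) = mmul (free_mon m) n.
Proof.
move=> nX; rewrite /free_mon.
have -> : partX (mmul m n) = partX m.
  by apply/eqP/cmP => x; rewrite !partXE cmM nX addn0.
have -> : partY (mmul m n) = mmul (partY m) n; last by rewrite mulmA.
apply/eqP/cmP => i; rewrite cmM !partYE cmM.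
by case E: (left_var i) => [x|//]; rewrite (left_varE E) nX.
Qed.

Lemma free_mon_monX u : free_mon (monX u) = ucm (var_y u).
Proof.
rewrite /free_mon.
have -> : partX (monX u) = u by apply/eqP/cmP => x; rewrite partXE monXE.
have -> : partY (monX u) = mone; last by rewrite mulm1.
by apply/eqP/cmP => i; rewrite partYE monXE cm1; case: left_var.
Qed.

(* Membership in the subalgebra R[Y]. With linearity and [mon_decomp],
   [free_opE] is the characterization f_X(uv) = y_u v of f_X. *)
Definition in_RY (v : {malg R[{cmonom free_var}]}) : Prop :=
  forall m, m \in msupp v -> forall x : X, m (var_x x) = 0%N.

Lemma free_opE (u : {cmonom X}) (v : {malg R[{cmonom free_var}]}) :
  in_RY v -> free_op (<< monX u >> * v) = << ucm (var_y u) >> * v.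
Proof.
move=> vY; apply: monlinM => m mv.
by rewrite free_monM ?free_mon_monX //; apply: vY.
Qed.

Lemma free_op_averaging : is_averaging free_op.
Proof.
apply: monlin_averaging => m n; apply: free_monM => x.
by rewrite cmM ucmE partYE.
Qed.

Definition free_averaging : averagingAlg R :=
  @AveragingAlg R {malg R[{cmonom free_var}]} free_op free_op_averaging.

End FreeAveraging.

(* Main.v *)
Require Import Defs.
From Stdlib Require Import Classical ClassicalEpsilon.
From mathcomp Require Import all_boot all_algebra finmap.
From mathcomp Require Import monalg.

(** If X is empty, F_X = R[y_1] and f_X is multiplication by y_1, so the
    averaging ideals are the ideals and Hilbert's basis theorem applies.
    If x is in X, an ideal generated by a set of variables y_theta is averaging,
    because f_X preserves the factor in R[Y] of each monomial; hence the ideals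
    generated by y_(x^0), ..., y_(x^n) form a strictly ascending chain. *)

Set Implicit Arguments.
Unset Strict Implicit.
Unset Printing Implicit Defensive.

Import GRing.Theory.
Local Open Scope ring_scope.

Lemma ascending_le (A : Type) (I : nat -> A -> Prop) :
  (forall n a, I n a -> I n.+1 a) ->
  forall m n a, (m <= n)%N -> I m a -> I n a.
Proof.
move=> incI m n a /subnK <-.
by elim: (n - m)%N => // k IHk /IHk; rewrite addSn; apply: incI.
Qed.

(** If the chain never became stationary, each index would have a later one with a strictly larger
    ideal; iterating such a choice from 0 extracts a strictly ascending subchain. *)
Lemma noetherian_stationary (A : comNzRingType) (I : nat -> A -> Prop) :
  noetherian_ring A -> (forall n, is_ideal (I n)) ->
  (forall n a, I n a -> I n.+1 a) ->
  exists N, forall n a, (N <= n)%N -> I n a -> I N a.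
Proof.
move=> noethA idI incI; apply: NNPP => notstat.
have next N : {n | (N <= n)%N /\ exists a, I n a /\ ~ I N a}.
  apply: constructive_indefinite_description; apply: NNPP => nonext.
  apply: notstat; exists N => n a leNn Ina; apply: NNPP => notINa.
  by apply: nonext; exists n; split=> //; exists a.
apply: noethA; exists (fun n => I (iter n (fun N => sval (next N)) 0%N)).
split=> // n; case: (svalP (next (iter n (fun N => sval (next N)) 0%N))).
by move=> le_next new; split=> // a; apply: ascending_le.
Qed.

Section HilbertBasis.
Variable R : comNzRingType.

(** The ideal of leading coefficients in degree [d]; bounding the size instead of fixing it admits 0
    and sums whose leading terms cancel. *)
Definition coef_ideal (I : {poly R} -> Prop) (d : nat) (c : R) : Prop :=
  exists p, [/\ I p, (size p <= d.+1)%N & p`_d = c].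

Lemma coef_ideal_is_ideal I d : is_ideal I -> is_ideal (coef_ideal I d).
Proof.
move=> [I0 ID IM]; split=> [|_ _ [p [Ip sp <-]] [q [Iq sq <-]]|a _ [p [Ip sp <-]]].
- by exists 0; rewrite size_poly0 coef0.
- exists (p + q); rewrite coefD; split=> //; first exact: ID.
  by rewrite (leq_trans (size_polyD _ _)) // geq_max sp.
- exists (a%:P * p); rewrite coefCM; split=> //; first exact: IM.
  by rewrite mul_polyC (leq_trans (size_scale_leq _ _)).
Qed.

Lemma coef_idealS I d c :
  is_ideal I -> coef_ideal I d c -> coef_ideal I d.+1 c.
Proof.
move=> [_ _ IM] [p [Ip sp <-]]; exists ('X * p); split; first exact: IM.
  by rewrite (leq_trans (size_polyMleq _ _)) // size_polyX.
by rewrite coefXM.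
Qed.

(** Induction on the size: subtracting some [q] in [I] with the same top coefficient as [p] leaves
    an element of [J] of smaller size. *)
Lemma coef_ideal_sub (I J : {poly R} -> Prop) :
  is_ideal I -> is_ideal J -> (forall p, I p -> J p) ->
  (forall d c, coef_ideal J d c -> coef_ideal I d c) ->
  forall p, J p -> I p.
Proof.
move=> [I0 ID IM] [_ JD JM] subIJ subL p.
move: {2}(size p) (leqnn (size p)) => s; elim: s p => [|s IHs] p les Jp.
  by have /eqP-> : p == 0 by rewrite -size_poly_leq0.
have [q [Iq sq Eq]] : coef_ideal I s p`_s by apply: subL; exists p.
rewrite -[p](subrK q); apply: ID => //; apply: IHs; last first.
  by rewrite -mulN1r; apply: JD => //; apply/JM/subIJ.
apply/leq_sizeP => j; rewrite leq_eqVlt => /predU1P[<-|lt_sj].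
  by rewrite coefB Eq subrr.
by rewrite coefB !nth_default ?subrr // (leq_trans _ lt_sj).
Qed.

(** The ideals [L n d] grow in both indices. Stability of the diagonal [L n n] from [N] on controls
    all degrees [d >= N]; the finitely many smaller degrees share a bound [M]. Hence [I P] and
    [I P.+1] have the same coefficient ideals for [P = maxn M N]. *)
Lemma hilbert_basis : noetherian_ring R -> noetherian_ring {poly R}.
Proof.
move=> noethR [I [idI ascI]].
have incI n p : I n p -> I n.+1 p by case: (ascI n) => incn _; apply: incn.
pose L n d := coef_ideal (I n) d.
have idL n d : is_ideal (L n d) by apply: coef_ideal_is_ideal.
have incLn m n d c : (m <= n)%N -> L m d c -> L n d c.
  by move=> lemn [p [Ip sp Ep]]; exists p; split=> //; apply: ascending_le Ip.
have incLd n d e c : (d <= e)%N -> L n d c -> L n e c.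
  by apply: (ascending_le (I := L n)) => k a; apply: coef_idealS.
have [N statN] : exists N, forall n c, (N <= n)%N -> L n n c -> L N N c.
  apply: (noetherian_stationary (I := fun n => L n n)) => // n c Lnn.
  by apply: incLd (leqnSn n) _; apply: incLn Lnn.
have [M statM] : exists M, forall d, (d < N)%N ->
    forall n c, (M <= n)%N -> L n d c -> L M d c.
  elim: (N) => [|k [M statM]]; first by exists 0%N.
  have [M' statM'] : exists M', forall n c, (M' <= n)%N -> L n k c -> L M' k c.
    by apply: (noetherian_stationary (I := fun n => L n k)) => // n c; apply: incLn.
  exists (maxn M M') => d; rewrite ltnS leq_eqVlt => ledk n c.
  rewrite geq_max => /andP[leMn leM'n] Lnd.
  case/predU1P: ledk => [Edk|ltdk].
    by apply: (incLn M'); rewrite ?leq_maxr // Edk in Lnd *; apply: statM' Lnd.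
  by apply: (incLn M); rewrite ?leq_maxl //; apply: statM Lnd.
pose P := maxn M N; have [_ [p [Ip notIp]]] := ascI P.
apply/notIp/(@coef_ideal_sub (I P) (I P.+1)) => // [|d c LPd]; first exact: incI.
have [ltdN|leNd] := ltnP d N.
  apply: (incLn M); rewrite ?leq_maxl //.
  by apply: (statM _ ltdN P.+1) => //; rewrite leqW // leq_maxl.
(* Pass through the diagonal: [L P.+1 d] lies in [L n n] for [n = maxn P.+1 d], hence in [L N N],
   hence in [L P d]. *)
apply: (incLn N); rewrite ?leq_maxr //; apply: (incLd _ _ _ _ leNd).
apply: (statN (maxn P.+1 d)); first by rewrite leq_max leNd orbT.
by apply: incLd (leq_maxr _ _) _; apply: incLn (leq_maxl _ _) LPd.
Qed.

End HilbertBasis.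

(** Pull the chain back along [f]; surjectivity keeps the inclusions strict. *)
Lemma noetherian_surj (A B : comNzRingType) (f : {rmorphism A -> B}) :
  (forall b, exists a, f a = b) -> noetherian_ring A -> noetherian_ring B.
Proof.
move=> surjf noethA [I [idI ascI]]; apply: noethA.
exists (fun n a => I n (f a)); split=> n.
  have [I0 ID IM] := idI n; split=> [|a b|a b]; rewrite ?rmorph0 //.
    by rewrite rmorphD; apply: ID.
  by rewrite rmorphM; apply: IM.
have [incn [b [Ib notIb]]] := ascI n; split=> [a|]; first exact: incn.
by have [a Ea] := surjf b; exists a; rewrite Ea.
Qed.

Definition cmonom_exp (I : choiceType) (m : {cmonom I}) (n : nat) : {cmonom I} :=
  iter n (mmul m) mone.

Lemma cmonom_expE (I : choiceType) (m : {cmonom I}) n i :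
  cmonom_exp m n i = (n * m i)%N.
Proof.
by elim: n => [|n IHn]; [rewrite cm1 | rewrite cmM IHn mulSn].
Qed.

Section FreeAveragingChain.
Variables (R : comNzRingType) (X : choiceType).

Local Notation K := {cmonom (free_var X)}.

Lemma noetherian_free_empty : noetherian_ring R -> (X -> False) ->
  noetherian_ring {malg R[K]}.
Proof.
move=> noethR X0; pose y := var_y (mone : {cmonom X}).
apply: (noetherian_surj (f := horner_alg (<< ucm y >> : {malg R[K]}))); last first.
  exact: hilbert_basis.
elim/malg_lin_ind => [|c _ _ [p <-] [q <-]|m].
- by exists 0; rewrite rmorph0.
- by exists (c%:P * p + q); rewrite rmorphD rmorphM /= horner_algC mulr_algl.
(* Over an empty [X] the only monomial is [mone], so [y] is the only variable and evaluation at it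
   is onto. *)
have yE i : i = y.
  by case: i => [/X0 //|u]; congr inr; apply/eqP/cmP => x; case: (X0 x).
exists ('X^(m y)); rewrite rmorphXn /= horner_algX.
transitivity (<< cmonom_exp (ucm y) (m y) >> : {malg R[K]}).
  elim: (m y) => [|k IHk]; first by rewrite expr0.
  by rewrite exprS IHk [RHS]malgUM.
by congr << _ >>; apply/eqP/cmP => i; rewrite (yE i) cmonom_expE ucmE eqxx muln1.
Qed.

(** The ideal generated by the variables in [Z], described through supports so that membership is
    tested monomial by monomial. *)
Definition mem_var_ideal (Z : free_var X -> Prop) (g : {malg R[K]}) : Prop :=
  forall m, m \in msupp g -> exists2 z, Z z & m z != 0%N.

Lemma var_ideal_is_ideal Z : is_ideal (mem_var_ideal Z).
Proof.
split=> [m|a b Ia Ib m|a b Ib m]; first by rewrite msupp0.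
  by move/(fsubsetP (msuppD_le a b)); rewrite in_fsetU => /orP[/Ia|/Ib].
case/msuppM_le => m1 [m2] [_ /Ib[z Zz nz] ->].
by exists z; rewrite // cmM addn_eq0 negb_and nz orbT.
Qed.

Lemma var_ideal_averaging Z : (forall x, ~ Z (var_x x)) ->
  @is_averaging_ideal R (free_averaging R X) (mem_var_ideal Z).
Proof.
move=> ZY; split=> [|g Ig /=]; first exact: var_ideal_is_ideal.
have [I0 ID IM] := var_ideal_is_ideal Z.
rewrite /free_op /monlin big_seq; apply: big_ind => // m mg k.
move/(fsubsetP (msuppZ_le _ _))/(fsubsetP msuppU_le); rewrite in_fset1 => /eqP->.
have [z Zz nz] := Ig m mg; exists z => //.
rewrite /free_mon cmM addn_eq0 negb_and partYE.
(* Since [z] is some y_theta, its exponent in [partY m] is the one in [m]. *)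
by case: z Zz nz => [x /ZY //|u] _ ->; rewrite orbT.
Qed.

Lemma mem_var_idealU Z z : mem_var_ideal Z << ucm z >> <-> Z z.
Proof.
split=> [/(_ (ucm z))|Zz m].
  (* The support is nonempty because 1 differs from 0 in [R]. *)
  rewrite msuppU oner_eq0 in_fset1 eqxx => /(_ isT)[t Zt].
  by rewrite ucmE; case: (eqVneq z t) => [->|].
by rewrite msuppU oner_eq0 in_fset1 => /eqP->; exists z; rewrite // ucmE eqxx.
Qed.

Lemma free_nonempty_not_noetherian (x : X) :
  ~ noetherian_averaging (free_averaging R X).
Proof.
pose y k := var_y (cmonom_exp (ucm x) k).
have injy : injective y.
  move=> j k [] /(congr1 (fun m : {cmonom X} => m x)).
  by rewrite !cmonom_expE ucmE eqxx !muln1.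
(* The chain starts at the zero ideal, as [Z 0] is empty; stage [n.+1] gains [y n], which is new by
   [injy]. *)
pose Z n z := exists2 k, (k < n)%N & z = y k.
apply; exists (fun n => mem_var_ideal (Z n)); split=> n.
  by apply: var_ideal_averaging => t [].
split=> [g Ig m /Ig[z [k ltkn ->] nz]|].
  by exists (y k) => //; exists k; rewrite // ltnW.
exists << ucm (y n) >>; split; first by apply/mem_var_idealU; exists n.
by case/mem_var_idealU => k /[swap] /injy ->; rewrite ltnn.
Qed.

End FreeAveragingChain.

Theorem theorem3p4 (R : comNzRingType) (X : choiceType) :
  noetherian_ring R ->
  (noetherian_averaging (free_averaging R X) <-> (X -> False)).
Proof.
move=> noethR; split=> [noethF x|X0 [I [avgI ascI]]].
  exact: free_nonempty_not_noetherian noethF.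
(* A chain of averaging ideals is in particular a chain of ideals of the underlying ring. *)
apply: (noetherian_free_empty noethR X0); exists I; split=> // n.
by case: (avgI n).
Qed.
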